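(* Let $q\in(0,1)$. Assume that the partitions $\lambda\in\Lambda_n$, $\nu\in\Lambda_{n-1}$ are such that there exists a unique index $1\le s\le n$ such that $$\max\{\nu_s,\lambda_{s+1}\}<\min\{\nu_{s-1},\lambda_s\}$$ and $$\max\{\nu_j,\lambda_{j+1}\}=\min\{\nu_{j-1},\lambda_j\}\quad\text{for }j\ne s,\ 1\le j\le n.$$ Then the limit $\lim_{t_0\to0}P_{\lambda\setminus\nu}(x;q,t_0)$ exists and $Q^{(n-1,n)}_{x,q}(\nu,\lambda)=\lim_{t_0\to0}P_{\lambda\setminus\nu}(x;q,t_0)$.
   Context: **Partitions.** $\Lambda_n=\{\lambda\in\mathbb Z^n:\lambda_1\ge\dots\ge\lambda_n\ge0\}$, $|\lambda|=\sum_i\lambda_i$, $\lambda^\top_i=|\{j:\lambda_j\ge i\}|$ (transpose), $\nu\preceq\mu$ iff $\mu_1\ge\nu_1\ge\mu_2\ge\nu_2\ge\cdots$. Conventions: $\nu_0=+\infty$, $\nu_n=0$ for $\nu\in\Lambda_{n-1}$, $\lambda_{n+1}=0$ for $\lambda\in\Lambda_n$. $\binom mk_q=\frac{(q;q)_m}{(q;q)_k(q;q)_{m-k}}$, $(x;q)_m=\prod_{k=0}^{m-1}(1-xq^k)$. **The polynomial $Q$.** $$Q^{(n-1,n)}_{x,q}(\nu,\lambda)=\sum_{\mu\in\Lambda_n:\ \nu\preceq\mu\preceq\lambda}x^{2|\mu|-|\nu|-|\lambda|}\prod_{i=1}^{n-1}\binom{\lambda_i-\lambda_{i+1}}{\lambda_i-\mu_i}_q\binom{\mu_i-\mu_{i+1}}{\mu_i-\nu_i}_q\binom{\lambda_n}{\lambda_n-\mu_n}_q.$$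 **The branching polynomial $P_{\lambda\setminus\nu}(x;q,t_0)$** (of the deformed hyperoctahedral $q$-Whittaker functions with parameters $(t_0,0,0,0)$, $0<|t_0|<1$). For $\lambda\in\Lambda_n,\nu\in\Lambda_{n-1}$ with $\lambda^\top_i-\nu^\top_i\in\{0,1,2\}$ for all $1\le i\le m:=l(\lambda^\top)=\lambda_1$, let $d=|\{1\le i\le m:\lambda^\top_i-\nu^\top_i=1\}|$ and $$P_{\lambda\setminus\nu}(x;q,t_0)=\sum_{r=0}^dB^r_{\lambda\setminus\nu}(q,t_0)\langle x;t_0\rangle_{q,r},\qquad \langle x;t_0\rangle_{q,0}=1,\quad \langle x;t_0\rangle_{q,r}=\prod_{l=1}^r(x+x^{-1}-t_0q^{l-1}-t_0^{-1}q^{-(l-1)}),$$ $$B^r_{\lambda\setminus\nu}(q,t_0)=c(\lambda,\nu;q)\sum_{\substack{I_+,I_-\subset J^{\mathsf c},\ I_+\cap I_-=\emptyset\\|I_+|+|I_-|=d-r}}A(\nu^*;I_+,I_-,t_0),\qquad c(\lambda,\nu;q)=\prod_{\substack{1\le j<k\le m\\ \nu^\top_k<\nu^\top_j,\ \lambda^\top_k=\lambda^\top_j}}\frac{1-q^{1+k-j}}{1-q^{k-j}},$$ where $\nu^*_j=n-\nu^\top_{m-j+1}$, $\lambda^*_j=n+1-\lambda^\top_{m-j+1}$ ($1\le j\le m$), $J^{\mathsf c}=\{1\le j\le m:\nu^*_j=\lambda^*_j\}$, and $$A(\nu^*;I_+,I_-,t_0)=\prod_{\substack{j,k\in J^{\mathsf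 c}\\ \nu^*_j=\nu^*_k,\ \epsilon_j>\epsilon_k}}\frac{1-q^{1+k-j}}{1-q^{k-j}}\prod_{\substack{j\in I_-,k\in I_+\\ \nu^*_j=\nu^*_k+1}}\frac{1-q^{1+k-j}}{1-q^{k-j}}\prod_{j\in J^{\mathsf c}}t_0^{-\epsilon_j}\prod_{\substack{j,k\in J^{\mathsf c},\ j<k\\ \epsilon_j\ne\epsilon_k=0}}q^{-\epsilon_j}\prod_{\substack{j,k\in J^{\mathsf c},\ j<k\\ \nu^*_j=\nu^*_k,\ \epsilon_k-\epsilon_j=1}}q^{-1},$$ with $\epsilon_j=1$ if $j\in I_+$, $\epsilon_j=-1$ if $j\in I_-$, and $\epsilon_j=0$ if $j\in J^{\mathsf c}\setminus(I_+\cup I_-)$. *)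

(* Defs.v *)
From HB Require Import structures.
From mathcomp Require Import all_boot all_order all_algebra.
From mathcomp Require Import complex.
From mathcomp Require Import all_classical all_reals topology normedtype.

Set Implicit Arguments.
Unset Strict Implicit.
Unset Printing Implicit Defensive.

Import GRing.Theory Num.Theory.
Local Open Scope ring_scope.

(* The complex numbers, packed as a numFieldType: the topology of a numFieldType
   is attached to such a packed structure and is not found on R[i] itself. *)
Definition Cplx (R : realType) : numFieldType := R[i].

Definition Lambda (n : nat) : pred (seq nat) :=
  [pred l | (size l == n) && sorted geq l].

(* [part l i] is the i-th part for i >= 1; it is 0 beyond the end of [l], which
   gives the conventions lambda_(n+1) = 0 and nu_n = 0. *)
Definition part (l : seq nat) (i : nat) : nat := nth 0%N l i.-1.

(* The i-th part of the transposed partition, for i >= 1. *)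
Definition trpart (l : seq nat) (i : nat) : nat := count (fun p => (i <= p)%N) l.

(* Comparing the parts up to index [size mu] suffices, both for nu of length
   [size mu] and for nu of length [(size mu).-1]. *)
Definition interlace (nu mu : seq nat) : bool :=
  all (fun i => (part mu i.+1 <= part nu i <= part mu i)%N) (iota 1 (size mu)).

(* min {nu_(j-1), lambda_j}, with nu_0 = +oo. *)
Definition min_prev (nu lam : seq nat) (j : nat) : nat :=
  if j == 1%N then part lam 1 else minn (part nu j.-1) (part lam j).

Section Polynomials.
Variable F : fieldType.
Implicit Types (x q : F) (lam nu mu : seq nat).

Definition qpoch x q (m : nat) : F := \prod_(k < m) (1 - x * q ^+ k).

(* Meaningful for k <= m only. *)
Definition qbinom q (m k : nat) : F :=
  qpoch q q m / (qpoch q q k * qpoch q q (m - k)).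

Definition Qweight (n : nat) x q nu lam mu : F :=
  x ^ (2 * (sumn mu)%:Z - (sumn nu)%:Z - (sumn lam)%:Z)
  * (\prod_(1 <= i < n)
       (qbinom q (part lam i - part lam i.+1) (part lam i - part mu i)
        * qbinom q (part mu i - part mu i.+1) (part mu i - part nu i)))
  * qbinom q (part lam n) (part lam n - part mu n).

(* The parts of mu range over 0..lambda_1, since mu <= lambda in the
   interlacing order forces mu_i <= lambda_1. *)
Definition Qpoly (n : nat) x q nu lam : F :=
  \sum_(t : n.-tuple 'I_(part lam 1).+1 |
         let mu := [seq val p | p <- t] in
         [&& mu \in Lambda n, interlace nu mu & interlace mu lam])
    Qweight n x q nu lam [seq val p | p <- t].

Definition qratio q (a : int) : F := (1 - q ^ (1 + a)) / (1 - q ^ a).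

Definition askey x q (t0 : F) (r : nat) : F :=
  \prod_(1 <= l < r.+1) (x + x^-1 - t0 * q ^+ l.-1 - t0^-1 * q ^- l.-1).

(* Below, m = lambda_1, and an ordinal j : 'I_m stands for the index j + 1 of
   {1, ..., m}. The truncated subtractions are exact, because nu has n - 1
   parts and lambda has n parts. *)
Definition nustar (n m : nat) nu (j : 'I_m) : nat := (n - trpart nu (m - j))%N.

Definition lamstar (n m : nat) lam (j : 'I_m) : nat :=
  (n.+1 - trpart lam (m - j))%N.

Definition Jc (n m : nat) lam nu : {set 'I_m} :=
  [set j | nustar n nu j == lamstar n lam j].

Definition eps (m : nat) (Ip Im : {set 'I_m}) (j : 'I_m) : int :=
  if j \in Ip then 1 else if j \in Im then -1 else 0.

Definition Acoef (n m : nat) q (t0 : F) lam nu (Ip Im : {set 'I_m}) : F :=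
  let J := Jc n m lam nu in
  let e := eps Ip Im in
  let ns := @nustar n m nu in
  (\prod_(j in J) \prod_(k in J | (ns j == ns k) && (e k < e j))
      qratio q (k%:Z - j%:Z))
  * (\prod_(j in Im) \prod_(k in Ip | ns j == (ns k).+1)
      qratio q (k%:Z - j%:Z))
  * (\prod_(j in J) t0 ^ (- e j))
  * (\prod_(j in J) \prod_(k in J | [&& (j < k)%N, e j != e k & e k == 0])
      q ^ (- e j))
  * (\prod_(j in J) \prod_(k in J | [&& (j < k)%N, ns j == ns k & e k - e j == 1])
      q^-1).

Definition ccoef (m : nat) q lam nu : F :=
  \prod_(1 <= j < m.+1)
    \prod_(j.+1 <= k < m.+1 | (trpart nu k < trpart nu j)%N
                              && (trpart lam k == trpart lam j))
      qratio q (k%:Z - j%:Z).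

Definition ddeg (m : nat) lam nu : nat :=
  count (fun i => trpart lam i == (trpart nu i).+1) (iota 1 m).

Definition Bcoef (n : nat) q (t0 : F) lam nu (r : nat) : F :=
  let m := part lam 1 in
  let J := Jc n m lam nu in
  ccoef m q lam nu *
  \sum_(Ip : {set 'I_m} | Ip \subset J)
    \sum_(Im : {set 'I_m} | [&& Im \subset J, [disjoint Ip & Im]
                            & (#|Ip| + #|Im| == ddeg m lam nu - r)%N])
      Acoef n q t0 lam nu Ip Im.

(* The branching polynomial P_(lambda \ nu)(x; q, t0), for lambda in Lambda n
   and nu in Lambda (n - 1) such that lambda^T_i - nu^T_i is 0, 1 or 2 for
   1 <= i <= lambda_1; the formula has no intended meaning otherwise. *)
Definition Pbranch (n : nat) x q (t0 : F) lam nu : F :=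
  \sum_(0 <= r < (ddeg (part lam 1) lam nu).+1)
    Bcoef n q t0 lam nu r * askey x q t0 r.

End Polynomials.

(* Main.v *)
Require Import Defs.
From HB Require Import structures.
From mathcomp Require Import all_boot all_order all_algebra.
From mathcomp Require Import complex.
From mathcomp Require Import all_classical all_reals topology normedtype.
From mathcomp Require Import ring zify.
Import Order.TTheory GRing.Theory Num.Theory numFieldNormedType.Exports.
Local Open Scope ring_scope.

(** The branching polynomial does not depend on [t0]: for every nonzero [t0] it
    already equals the polynomial Q, so its limit is that of a constant.

    Write [a] and [b] for the two bounds [max {nu_s, lam_(s+1)}] and
    [min {nu_(s-1), lam_s}], and [d = b - a]. The partitions [mu] between [nu]
    and [lam] have all their parts fixed except [mu_s = a + k] with
    [0 <= k <= d]. In terms of columns, the heights of [lam] and [nu] differ by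
    one exactly on the columns [a + 1, ..., b]; so the set [Jc] is an interval of
    [d] consecutive indices, and the [nustar] are constant on it ([Jc_seg],
    [nustar_seg]).

    In the branching polynomial, a sign increase between neighbours in [Jc]
    produces the factor [1 - q ^ 0 = 0], so the signs must read +1 ([p] times),
    0 ([r] times), -1 (the rest) ([Acoef_neq0_seg]). The remaining products
    telescope to a q-multinomial coefficient ([prod_qratio_blocks]), and the sum
    over [p] is a Rogers-Szego polynomial in [t0^-1 * q ^- r] and [t0]
    ([sum_Acoef]). The sum over [r] against the basis [askey] is then the
    q-Hermite polynomial [sum_k gauss d k * x ^ (2 * k - d)], by comparison of
    three-term recurrences ([sum_askey_rogers_szego]).

    On the other side, the same telescoping computes [ccoef] as a product over
    the rows of q-multinomial coefficients ([ccoefE]). Cancelling factorials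
    between consecutive rows, the weight of [mu] in Q is [ccoef] times
    [gauss d k * x ^ (2 * k - d)] ([QweightE]), so Q is [ccoef] times the same
    q-Hermite polynomial. *)

(** * Gaussian binomials and Rogers-Szego polynomials *)

Section RogersSzego.
Variables (F : fieldType) (q : F).

Lemma qpochS m : qpoch q q m.+1 = qpoch q q m * (1 - q ^+ m.+1).
Proof. by rewrite /qpoch big_ord_recr /= -exprS. Qed.

(** The Gaussian binomial coefficients through the Pascal rule: unlike the
    quotient of q-factorials they vanish for [k > n], so that sums over [k] can
    be extended and shifted without boundary terms. *)
Fixpoint gauss (n k : nat) : F :=
  match n, k with
  | _, 0 => 1
  | 0, _.+1 => 0
  | n'.+1, k'.+1 => gauss n' k' + q ^+ k'.+1 * gauss n' k'.+1
  end.

Lemma gauss0 n : gauss n 0 = 1. Proof. by case: n. Qed.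

Lemma gaussS n k : gauss n.+1 k.+1 = gauss n k + q ^+ k.+1 * gauss n k.+1.
Proof. by []. Qed.

Arguments gauss : simpl never.

Lemma gauss_gt n k : (n < k)%N -> gauss n k = 0.
Proof.
elim: n k => [|n IH] [|k] // lt_nk; rewrite gaussS.
by rewrite !IH ?mulr0 ?addr0 // ltnW.
Qed.

Lemma gauss_self n : gauss n n = 1.
Proof. by elim: n => // n IH; rewrite gaussS IH gauss_gt ?mulr0 ?addr0. Qed.

Lemma gauss_qpoch n k : (k <= n)%N ->
  gauss n k * (qpoch q q k * qpoch q q (n - k)) = qpoch q q n.
Proof.
elim: n k => [|n IH] [|k] // le_kn.
- by rewrite gauss0 /qpoch big_ord0 !mul1r.
- by rewrite gauss0 subn0 {1}/qpoch big_ord0 !mul1r.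
rewrite gaussS subSS.
have e1 := IH k le_kn.
rewrite (qpochS n) (qpochS k) -e1.
have [lt_kn|le_nk] := ltnP k n; last first.
  have -> : n = k by apply/eqP; rewrite eqn_leq le_nk -ltnS.
  rewrite (@gauss_gt _ k.+1) //; ring.
have e2 := IH k.+1 lt_kn.
have eS : (n - k)%N = (n - k.+1).+1 by lia.
rewrite eS (qpochS (n - k.+1)%N) in e1 *.
rewrite (qpochS k) in e2.
have -> : q ^+ n.+1 = q ^+ k.+1 * q ^+ (n - k.+1).+1.
  by rewrite -exprD; congr (_ ^+ _); lia.
move: (q ^+ k.+1) (q ^+ _.+1) e1 e2 => y z e1 e2.
apply/eqP; rewrite -subr_eq0; apply/eqP.
transitivity (y * (1 - z) *
  (gauss n k.+1 * (qpoch q q k * (1 - y) * qpoch q q (n - k.+1))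
   - gauss n k * (qpoch q q k * (qpoch q q (n - k.+1) * (1 - z))))); first by ring.
by rewrite e2 e1 subrr mulr0.
Qed.

(** The homogeneous Rogers-Szego polynomial, whose expansion is
    [rogers_szego_sum]. The recursion is the Pascal rule summed against
    [u ^+ p * v ^+ (n - p)]; the factor [q ^+ p] of that rule becomes the
    dilation of [u]. *)
Fixpoint rogers_szego (u v : F) (n : nat) : F :=
  if n is n'.+1 then v * rogers_szego (q * u) v n' + u * rogers_szego u v n' else 1.

Lemma rogers_szegoS u v n :
  rogers_szego u v n.+1 = v * rogers_szego (q * u) v n + u * rogers_szego u v n.
Proof. by []. Qed.

(** This trades a dilation of [u] for a drop of the degree, and so turns the
    defining recursion into a three-term recurrence at fixed [u] and [v]. *)
Lemma rogers_szego_shift u v n :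
  rogers_szego (q * u) v n.+1 =
  rogers_szego u v n.+1 - u * (1 - q ^+ n.+1) * rogers_szego u v n.
Proof.
elim: n u => [|n IH] u; first by rewrite /=; ring.
rewrite rogers_szegoS (IH (q * u)) (rogers_szegoS u v n.+1) (IH u).
by rewrite (rogers_szegoS u v n) (exprS _ n.+1); ring.
Qed.

Lemma rogers_szego_rec u v n :
  rogers_szego u v n.+2 =
  (u + v) * rogers_szego u v n.+1 - u * v * (1 - q ^+ n.+1) * rogers_szego u v n.
Proof. by rewrite rogers_szegoS rogers_szego_shift; ring. Qed.

Lemma rogers_szego_sum u v n :
  rogers_szego u v n = \sum_(0 <= p < n.+1) gauss n p * u ^+ p * v ^+ (n - p).
Proof.
elim: n u => [|n IH] u; first by rewrite big_nat1 /= !mulr1.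
rewrite rogers_szegoS !IH [RHS]big_nat_recl //.
under [in RHS]eq_bigr do rewrite gaussS subSS 2!mulrDl.
rewrite big_split /= ?gauss0 ?subn0 [RHS]addrCA [LHS]addrC; congr (_ + _).
  by rewrite big_distrr /=; apply: eq_bigr => i _; rewrite exprS; ring.
rewrite [in RHS]big_nat_recr //= gauss_gt // mulr0 !mul0r addr0.
rewrite big_nat_recl //= mulrDr gauss0 subn0; congr (_ + _).
  by rewrite !expr0 exprS; ring.
rewrite big_distrr /= !big_nat; apply: eq_bigr => i /andP[_ lt_in].
have -> : (n - i)%N = (n - i.+1).+1 by lia.
by rewrite exprMn (exprS v); ring.
Qed.

Hypothesis q1 : forall k, (0 < k)%N -> q ^+ k != 1.

Lemma qpoch_neq0 n : qpoch q q n != 0.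
Proof.
by apply/prodf_neq0 => i _; rewrite -exprS subr_eq0 eq_sym q1.
Qed.

Lemma gauss_neq0 n k : (k <= n)%N -> gauss n k != 0.
Proof.
move=> le_kn; have := qpoch_neq0 n; rewrite -(gauss_qpoch n k le_kn).
by rewrite mulf_eq0 negb_or => /andP[].
Qed.

Lemma gauss_upper n k :
  (1 - q ^+ (n - k)) * gauss n k = (1 - q ^+ k.+1) * gauss n k.+1.
Proof.
have [lt_kn|le_nk] := ltnP k n; last first.
  have -> : (n - k = 0)%N by lia.
  by rewrite expr0 subrr mul0r (@gauss_gt _ k.+1) // mulr0.
have e1 := gauss_qpoch n k (ltnW lt_kn); have e2 := gauss_qpoch n k.+1 lt_kn.
apply: (mulIf (qpoch_neq0 k)); apply: (mulIf (qpoch_neq0 (n - k.+1))).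
have eS : (n - k)%N = (n - k.+1).+1 by lia.
rewrite eS (qpochS (n - k.+1)%N) in e1 *; rewrite (qpochS k) -e1 in e2.
apply/esym/eqP; rewrite -subr_eq0; apply/eqP.
by move/eqP: e2; rewrite -subr_eq0 => /eqP <-; ring.
Qed.

Lemma gauss_absorb n k : (k <= n.+1)%N ->
  (1 - q ^+ n.+1) * gauss n k = (1 - q ^+ (n.+1 - k)) * gauss n.+1 k.
Proof.
case: k => [|k]; first by rewrite !gauss0 subn0.
rewrite ltnS subSS gaussS => le_kn.
rewrite mulrDr gauss_upper.
have -> : q ^+ n.+1 = q ^+ (n - k) * q ^+ k.+1.
  by rewrite -exprD; congr (_ ^+ _); lia.
ring.
Qed.

Hypothesis q0 : q != 0.

Lemma askeyS (x t0 : F) r : askey x q t0 r.+1 =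
  askey x q t0 r * (x + x^-1 - t0 * q ^+ r - t0^-1 * q ^- r).
Proof. by rewrite /askey big_nat_recr. Qed.

(** The sum on the left does not depend on [t0]: it expands the continuous
    q-Hermite polynomial in the Askey-type basis [askey]. Both sides satisfy the
    three-term recurrence of the q-Hermite polynomials in [d] with the same
    initial values. On the left, multiplication by [x + x^-1] shifts the basis
    by [askeyS], and the recurrence becomes an identity [CS] between the
    coefficients [C d r], which follows from the rules for [gauss] and from
    [rogers_szego_rec], where the two arguments have product [q ^- r]. *)
Lemma sum_askey_rogers_szego (x t0 : F) d : x != 0 -> t0 != 0 ->
  \sum_(0 <= r < d.+1)
     gauss d r * rogers_szego (t0^-1 * q ^- r) t0 (d - r) * askey x q t0 r
  = rogers_szego x x^-1 d.
Proof.
move=> x0 t00.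
pose C d r := gauss d r * rogers_szego (t0^-1 * q ^- r) t0 (d - r).
pose S d := \sum_(0 <= r < d.+1) C d r * askey x q t0 r.
pose tau r := t0 * q ^+ r + t0^-1 * q ^- r.
have Cgt m r : (m < r)%N -> C m r = 0 by move=> ?; rewrite /C gauss_gt ?mul0r.
have a0 : askey x q t0 0 = 1 by rewrite /askey big_geq.
have C0 m : C m.+2 0 = tau 0 * C m.+1 0 - (1 - q ^+ m.+1) * C m 0.
  rewrite /C /tau !gauss0 !subn0 rogers_szego_rec expr0 invr1 !mulr1 mulVf //; ring.
have CS m r : (r < m.+2)%N -> C m.+2 r.+1 =
    C m.+1 r + tau r.+1 * C m.+1 r.+1 - (1 - q ^+ m.+1) * C m r.+1.
  rewrite ltnS leq_eqVlt => /orP[/eqP->|lt_rm].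
    rewrite (Cgt m.+1 m.+2) // (Cgt m m.+2) // /C !gauss_self !subnn /=.
    by rewrite !mulr0 addr0 subr0.
  have up := gauss_upper m.+1 r.
  have ab := gauss_absorb m r.+1 lt_rm.
  rewrite /C (gaussS m.+1) !mulrA ab !subSS.
  rewrite (_ : (m.+1 - r = (m - r).+1)%N) in up *; last lia.
  have -> : t0^-1 * q ^- r = q * (t0^-1 * q ^- r.+1).
    by rewrite exprS invfM [RHS]mulrCA (mulrA q) mulfV // mul1r.
  set u := t0^-1 * q ^- r.+1.
  have uv : u * t0 * q ^+ r.+1 = 1.
    by rewrite /u mulrAC mulrVK ?unitfE ?expf_neq0 // mulVf.
  rewrite rogers_szego_shift /tau -/u.
  set g1 := gauss m.+1 r in up *; set g2 := gauss m.+1 r.+1 in up ab *.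
  (* The terms in [g1] of top degree cancel; [up'] turns the other one into a
     multiple of [g2], so that [g2] can be factored out. *)
  have up' z : g1 * (u * (1 - q ^+ (m - r).+1) * z) = (1 - q ^+ r.+1) * g2 * u * z.
    by rewrite -up; ring.
  rewrite mulrBr up'.
  case e : (m - r)%N => [|M].
    rewrite expr0 subrr !mul0r subr0 /=.
    by move: (q ^+ r.+1) uv => z uv; ring.
  have -> : (m - r.+1 = M)%N by lia.
  rewrite rogers_szego_rec; move: (q ^+ r.+1) uv => z uv.
  apply/eqP; rewrite -subr_eq0; apply/eqP.
  transitivity (g2 * (1 - q ^+ M.+1) * rogers_szego u t0 M * (1 - u * t0 * z)).
    by ring.
  by rewrite uv subrr mulr0.
have Srec m : S m.+2 = (x + x^-1) * S m.+1 - (1 - q ^+ m.+1) * S m.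
  have ext k r : S k = \sum_(0 <= i < k.+1 + r) C k i * askey x q t0 i.
    rewrite (big_cat_nat (n:=k.+1)) //= ?leq_addr // [X in _ + X]big_nat.
    rewrite [X in _ + X]big1 ?addr0 //.
    by move=> i /andP[? _]; rewrite Cgt ?mul0r.
  rewrite (ext m 2) addn2 {2}/S.
  have -> : (x + x^-1) * (\sum_(0 <= r < m.+2) C m.+1 r * askey x q t0 r) =
     \sum_(0 <= r < m.+2) C m.+1 r * askey x q t0 r.+1 +
     \sum_(0 <= r < m.+3) tau r * C m.+1 r * askey x q t0 r.
    rewrite [X in _ = _ + X]big_nat_recr //= Cgt // mulr0 mul0r addr0.
    rewrite -big_split big_distrr /=; apply: eq_bigr => r _.
    by rewrite askeyS /tau; ring.
  rewrite big_distrr /= -addrA -sumrB /S.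
  rewrite [LHS]big_nat_recl // [X in _ = _ + X]big_nat_recl //=.
  rewrite addrCA -big_split /=; congr (_ + _).
    by rewrite a0 C0; ring.
  by rewrite !big_nat; apply: eq_bigr => r /andP[_ ?]; rewrite CS //; ring.
rewrite -/(S d).
suff: S d = rogers_szego x x^-1 d /\ S d.+1 = rogers_szego x x^-1 d.+1 by case.
elim: d => [|d [IH1 IH2]].
  rewrite /S big_nat1 /= a0 !mulr1; split; first by rewrite /C gauss0 mulr1.
  rewrite big_nat_recl // big_nat1 askeyS a0 /C gauss0 gauss_self /= expr0 invr1.
  ring.
split=> //; rewrite Srec IH1 IH2 rogers_szego_rec mulfV //; ring.
Qed.

End RogersSzego.

(** * Products over pairs from distinct blocks *)

Section Blocks.
Variables (F : fieldType) (q : F).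
Hypothesis q1 : forall k, (0 < k)%N -> q ^+ k != 1.

Lemma qratioE j k : (j <= k)%N ->
  qratio q (k%:Z - j%:Z) = (1 - q ^+ (k - j).+1) / (1 - q ^+ (k - j)).
Proof. by move=> le_jk; rewrite /qratio subzn // -exprnP -exprnP. Qed.

Lemma one_subX_neq0 k : (0 < k)%N -> 1 - q ^+ k != 0.
Proof. by move=> k0; rewrite subr_eq0 eq_sym q1. Qed.

Lemma prod_qratio_col u v w : (u <= v)%N -> (v <= w)%N ->
  \prod_(u <= j < v) qratio q (w%:Z - j%:Z)
  = (1 - q ^+ (w - u).+1) / (1 - q ^+ (w - v).+1).
Proof.
elim: v => [|v IH]; rewrite leq_eqVlt => /orP[/eqP<-|lt_uv] le_vw.
- by rewrite big_geq // divff // one_subX_neq0.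
- by [].
- by rewrite big_geq // divff // one_subX_neq0.
rewrite big_nat_recr //= IH //; last exact: ltnW.
rewrite qratioE; last exact: ltnW.
have -> : (w - v)%N = (w - v.+1).+1 by lia.
by rewrite mulrA divfK // one_subX_neq0.
Qed.

(** Each step of the induction on [w] adds the column [k = w], whose product over
    [j] telescopes. *)
Lemma prod_qratio_rect u v w : (u <= v)%N -> (v <= w)%N ->
  \prod_(u <= j < v) \prod_(v <= k < w) qratio q (k%:Z - j%:Z)
  = qpoch q q (w - u) / (qpoch q q (v - u) * qpoch q q (w - v)).
Proof.
move=> le_uv; elim: w => [|w IH]; rewrite leq_eqVlt => /orP[/eqP<-|lt_vw].
- rewrite big1 => [|j _]; last by rewrite big_geq.
  by rewrite subnn /qpoch big_ord0 mulr1 divff // qpoch_neq0.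
- by [].
- rewrite big1 => [|j _]; last by rewrite big_geq.
  by rewrite subnn [qpoch q q 0]/qpoch big_ord0 mulr1 divff // qpoch_neq0.
under eq_bigr do rewrite big_nat_recr //=.
rewrite big_split /= IH // prod_qratio_col //.
have -> : (w.+1 - u = (w - u).+1)%N by lia.
have -> : (w.+1 - v = (w - v).+1)%N by lia.
by rewrite !qpochS mulrACA -invfM mulrA.
Qed.

Lemma big_nat_subrange (P : pred nat) (G : nat -> F) u v w z :
    (u <= v)%N -> (w <= z)%N ->
    (forall k, (u <= k < z)%N -> P k = (v <= k < w)%N) ->
  \prod_(u <= k < z | P k) G k = \prod_(v <= k < w) G k.
Proof.
move=> le_uv le_wz hP.
rewrite (big_nat_widenl v u) // (big_nat_widen _ w z) // 2!big_nat_cond [RHS]big_nat_cond.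
apply: eq_bigl => k; case: (boolP (u <= k < z)%N) => //= uk.
by rewrite hP.
Qed.

(** The pairs from distinct blocks are those of the first block with the rest and
    those of the second block with the third, so the q-multinomial coefficient
    arises as a product of two q-binomials. Both the constant [ccoef] and the
    surviving coefficients [Acoef] have this shape. *)
Lemma prod_qratio_blocks (c : rel nat) u v w z :
    (u <= v)%N -> (v <= w)%N -> (w <= z)%N ->
    (forall j k, (u <= j < z)%N -> (u <= k < z)%N ->
       c j k = ((j < v) && (v <= k)) || ((j < w) && (w <= k)))%N ->
  \prod_(u <= j < z) \prod_(u <= k < z | c j k) qratio q (k%:Z - j%:Z)
  = qpoch q q (z - u)
    / (qpoch q q (v - u) * qpoch q q (w - v) * qpoch q q (z - w)).
Proof.
move=> uv vw wz hc.
rewrite (big_cat_nat (n := v)) //=; last by lia.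
rewrite [X in _ * X](big_cat_nat (n := w)) //=.
have -> : \prod_(u <= j < v) \prod_(u <= k < z | c j k) qratio q (k%:Z - j%:Z)
    = \prod_(u <= j < v) \prod_(v <= k < z) qratio q (k%:Z - j%:Z).
  rewrite !big_nat; apply: eq_bigr => j hj; apply: big_nat_subrange => // k hk.
  by rewrite hc //; lia.
have -> : \prod_(v <= j < w) \prod_(u <= k < z | c j k) qratio q (k%:Z - j%:Z)
    = \prod_(v <= j < w) \prod_(w <= k < z) qratio q (k%:Z - j%:Z).
  rewrite !big_nat; apply: eq_bigr => j hj; apply: big_nat_subrange => // [|k hk].
    by lia.
  by rewrite hc //; lia.
have -> : \prod_(w <= j < z) \prod_(u <= k < z | c j k) qratio q (k%:Z - j%:Z) = 1.
  rewrite big_nat big1 // => j hj.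
  rewrite (@big_nat_subrange _ _ u u u z) ?big_geq //; first by lia.
  by move=> k hk; rewrite hc //; lia.
rewrite mulr1 !prod_qratio_rect //; last by lia.
by field; rewrite !qpoch_neq0.
Qed.

End Blocks.

(** * Sign patterns on an interval of columns *)

Section Segments.
Variable m : nat.

Definition seg (u v : nat) : {set 'I_m} := [set j : 'I_m | (u <= j < v)%N].

Lemma prod_seg (F : fieldType) (P : pred nat) (G : nat -> F) u v : (v <= m)%N ->
  \prod_(j in seg u v | P j) G j = \prod_(u <= j < v | P j) G j.
Proof.
move=> le_vm; rewrite (big_nat_widen _ v m) // big_geq_mkord.
by apply: eq_bigl => j; rewrite !inE andbC -andbA [(_ < v)%N && _]andbC.
Qed.

Lemma card_seg u v : (v <= m)%N -> #|seg u v| = (v - u)%N.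
Proof.
move=> le_vm; rewrite -sum1_card.
transitivity (\sum_(u <= j < v) 1)%N; last by rewrite sum_nat_const_nat muln1.
rewrite (big_nat_widen _ v m) // big_geq_mkord.
by apply: eq_bigl => j; rewrite !inE andbC.
Qed.

(** For [k] in [S] the whole segment from [u] to [k] lies in [S], which bounds
    [k] by the cardinal of [S]; equality follows by counting. *)
Lemma seg_of_down (S : {set 'I_m}) u v : (u <= v)%N -> (v <= m)%N ->
    S \subset seg u v ->
    (forall j k : 'I_m, j \in seg u v -> k \in S -> (j <= k)%N -> j \in S) ->
  S = seg u (u + #|S|).
Proof.
move=> le_uv le_vm sub down; apply/eqP; rewrite eqEcard.
have le_S : (#|S| <= v - u)%N by rewrite -card_seg // subset_leq_card.
rewrite card_seg; last by lia.
rewrite addKn leqnn andbT; apply/fintype.subsetP => k kS.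
have := fintype.subsetP sub k kS; rewrite !inE => /andP[le_uk lt_kv].
rewrite le_uk /=.
have : (#|seg u k.+1| <= #|S|)%N.
  apply/subset_leq_card/fintype.subsetP => j; rewrite inE => hj.
  by apply: (down j k) => //; rewrite ?inE; lia.
by rewrite card_seg //; move: #|S| (nat_of_ord k) le_uk => s i; lia.
Qed.

Lemma seg_of_up (S : {set 'I_m}) u v : (v <= m)%N ->
    S \subset seg u v ->
    (forall j k : 'I_m, j \in seg u v -> k \in S -> (k <= j)%N -> j \in S) ->
  S = seg (v - #|S|) v.
Proof.
move=> le_vm sub up; apply/eqP; rewrite eqEcard.
have le_S : (#|S| <= v - u)%N by rewrite -card_seg // subset_leq_card.
rewrite card_seg // subKn ?leqnn ?andbT; last by lia.
apply/fintype.subsetP => k kS.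
have := fintype.subsetP sub k kS; rewrite !inE => /andP[le_uk lt_kv].
rewrite lt_kv andbT.
have : (#|seg k v| <= #|S|)%N.
  apply/subset_leq_card/fintype.subsetP => j; rewrite inE => hj.
  by apply: (up j k) => //; rewrite ?inE; lia.
by rewrite card_seg //; move: #|S| (nat_of_ord k) lt_kv => s i; lia.
Qed.

End Segments.

Section Coefficients.
Variables (F : fieldType) (q : F).
Hypothesis q1 : forall k, (0 < k)%N -> q ^+ k != 1.
Variables (m n : nat) (lam nu : seq nat) (t0 : F) (g d : nat).
Hypotheses (hJ : Jc n m lam nu = seg m g (g + d)) (hgd : (g + d <= m)%N)
  (hns : forall j k : 'I_m, j \in seg m g (g + d) -> k \in seg m g (g + d) ->
      nustar n nu j = nustar n nu k).

Let A (Ip Im : {set 'I_m}) : F := Acoef n q t0 lam nu Ip Im.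

(** If the sign increased from [j] to [j + 1], the first product of [Acoef]
    would contain the ratio at exponent -1, whose numerator is [1 - q ^ 0 = 0].
    So a nonzero coefficient forces a weakly decreasing sequence of signs:
    first +1, then 0, then -1. *)
Lemma Acoef_neq0_seg (Ip Im : {set 'I_m}) :
    Ip \subset seg m g (g + d) -> Im \subset seg m g (g + d) -> [disjoint Ip & Im] ->
    A Ip Im != 0 ->
  Ip = seg m g (g + #|Ip|) /\ Im = seg m (g + d - #|Im|) (g + d).
Proof.
move=> sp sm dis; rewrite /A /Acoef hJ !mulf_eq0 !negb_or -!andbA => /andP[nz _].
have step (j k : 'I_m) : j \in seg m g (g + d) -> k \in seg m g (g + d) ->
    k = j.+1 :> nat -> (eps Ip Im k <= eps Ip Im j)%R.
  move=> hj hk kj; rewrite leNgt; apply/negP => lt_jk.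
  move/prodf_neq0/(_ k hk)/prodf_neq0/(_ j): nz.
  rewrite hj (hns _ _ hk hj) eqxx lt_jk => /(_ isT)/eqP; apply.
  rewrite /qratio.
  have -> : 1 + (j%:Z - k%:Z) = 0 by lia.
  by rewrite expr0z subrr mul0r.
have mono (j k : 'I_m) : j \in seg m g (g + d) -> k \in seg m g (g + d) ->
    (j <= k)%N -> (eps Ip Im k <= eps Ip Im j)%R.
  move=> hj; case: k => k; elim: k => [|k IH] hkm hk.
    rewrite leqn0 => /eqP j0; suff -> : j = Ordinal hkm by [].
    exact: val_inj.
  rewrite leq_eqVlt => /orP[/eqP jk|].
    by suff -> : j = Ordinal hkm by []; exact: val_inj.
  rewrite /= ltnS => jk.
  have hk' : Ordinal (ltnW hkm) \in seg m g (g + d).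
    by move: hj hk; rewrite !inE /=; lia.
  apply: le_trans (IH _ hk' jk); exact: step.
have eps_m k : k \in Im -> eps Ip Im k = -1.
  by move=> kI; rewrite /eps kI (disjointFl dis kI).
split.
  apply: (@seg_of_down m _ g (g + d)); rewrite ?leq_addr // => j k hj kI jk.
  have := mono j k hj (fintype.subsetP sp k kI) jk.
  by rewrite /eps kI; case: (j \in Ip) => //; case: ifP.
apply: (@seg_of_up m _ g (g + d)) => // j k hj kI kj.
have := mono k j (fintype.subsetP sm k kI) hj kj.
by rewrite (eps_m k kI) /eps; case: (j \in Ip); case: (j \in Im).
Qed.

(** The three blocks are the indices of sign +1, 0 and -1, of sizes [p], [r] and
    [d - p - r]. The factors [q^-1] come from the pairs of a +1 before a 0; the
    last product of [Acoef] is empty because the signs decrease. *)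
Lemma Acoef_seg p r : (p + r <= d)%N ->
  A (seg m g (g + p)) (seg m (g + p + r) (g + d)) =
  qpoch q q d / (qpoch q q p * qpoch q q r * qpoch q q (d - p - r))
  * (t0 ^- p * t0 ^+ (d - p - r)) * q ^- (p * r).
Proof.
move=> le_prd.
pose e (j : nat) : int :=
  if (g <= j < g + p)%N then 1 else if (g + p + r <= j < g + d)%N then -1 else 0.
pose sgn := eps (seg m g (g + p)) (seg m (g + p + r) (g + d)).
have eE (j : 'I_m) : sgn j = e j.
  by rewrite /sgn /eps !inE.
have prod_seg2 (P : rel nat) (P' : rel 'I_m) (G : nat -> nat -> F) :
    (forall j k : 'I_m, j \in seg m g (g + d) -> k \in seg m g (g + d) ->
       P' j k = P j k) ->
    \prod_(j in seg m g (g + d)) \prod_(k in seg m g (g + d) | P' j k) G j k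
    = \prod_(g <= j < g + d) \prod_(g <= k < g + d | P j k) G j k.
  move=> hP; rewrite -(prod_seg m _ xpredT) //.
  apply: eq_big => [j|j hj]; first by rewrite andbT.
  rewrite -(prod_seg m _ (P j)) //; apply: eq_bigl => k.
  by case: (boolP (k \in _)) => //= hk; rewrite hP.
rewrite /A /Acoef hJ -/sgn.
rewrite (prod_seg2 (fun j k => e k < e j) _ (fun j k => qratio q (k%:Z - j%:Z))); last first.
  by move=> j k hj hk; rewrite (hns _ _ hj hk) eqxx !eE.
rewrite (prod_qratio_blocks _ _ q1 _ _ (g + p) (g + p + r)); [|lia|lia|lia|]; last first.
  by move=> j k hj hk; rewrite /e; do 4?case: ifP; lia.
(* [nustar] is constant on the segment, so no pair contributes here. *)
have -> : \prod_(j in seg m (g + p + r) (g + d)) \prod_(k in seg m g (g + p) |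
     nustar n nu j == (nustar n nu k).+1) qratio q (k%:Z - j%:Z) = 1.
  rewrite big1 // => j hj; rewrite big_pred0 // => k.
  apply/andP => -[hk]; rewrite (hns j k); first by move/eqP/n_Sn.
    by move: hj; rewrite !inE; lia.
  by move: hk; rewrite !inE; lia.
have -> : \prod_(j in seg m g (g + d)) t0 ^ (- sgn j)
   = t0 ^- p * t0 ^+ (d - p - r).
  transitivity (\prod_(g <= j < g + d) t0 ^ (- e j)).
    rewrite -(prod_seg m _ xpredT) //; apply: eq_big => j; first by rewrite andbT.
    by rewrite eE.
  rewrite (big_cat_nat (n := g + p)) /=; [|lia|lia].
  rewrite [X in _ * X](big_cat_nat (n := g + p + r)) /=; [|lia|lia].
  have const u v z : (forall j, (u <= j < v)%N -> e j = z) ->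
      \prod_(u <= j < v) t0 ^ (- e j) = (t0 ^ (- z)) ^+ (v - u).
    move=> h; rewrite -prodr_const_nat !big_nat.
    by apply: eq_bigr => j hj; rewrite h.
  rewrite (const _ _ 1); last by move=> j hj; rewrite /e; do 2?case: ifP; lia.
  rewrite (const _ _ 0); last by move=> j hj; rewrite /e; do 2?case: ifP; lia.
  rewrite (const _ _ (-1)); last by move=> j hj; rewrite /e; do 2?case: ifP; lia.
  rewrite oppr0 expr0z expr1n mul1r opprK expr1z exprN1 exprVn.
  by congr (_ ^- _ * _ ^+ _); lia.
have -> : \prod_(j in seg m g (g + d)) \prod_(k in seg m g (g + d) | [&& (j < k)%N,
     sgn j != sgn k & sgn k == 0]) q ^ (- sgn j) = q ^- (p * r).
  transitivity (\prod_(g <= j < g + d) \prod_(g <= k < g + d |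
      [&& (j < k)%N, e j != e k & e k == 0]) q ^ (- e j)).
    rewrite -(prod_seg2 _ (fun j k => [&& (j < k)%N, sgn j != sgn k & sgn k == 0]));
      last by move=> j k _ _; rewrite !eE.
    by apply: eq_bigr => j _; apply: eq_bigr => k _; rewrite eE.
  rewrite (big_cat_nat (n := g + p)) /=; [|lia|lia].
  rewrite [X in _ * X]big_nat [X in _ * X]big1 ?mulr1; last first.
    move=> j hj; rewrite big_nat_cond big_pred0 // => k; apply/negbTE/negP.
    rewrite /e; do 4?case: ifP; lia.
  transitivity (\prod_(g <= j < g + p) q^-1 ^+ r).
    rewrite !big_nat; apply: eq_bigr => j hj.
    rewrite (big_nat_subrange _ _ _ _ (g + p) (g + p + r)); [|lia|lia|].
      rewrite prodr_const_nat.
      have -> : e j = 1 by rewrite /e; do 2?case: ifP; lia.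
      by rewrite exprN1; congr (_ ^+ _); lia.
    move=> k hk; rewrite /e; do 4?case: ifP; lia.
  by rewrite prodr_const_nat -exprM exprVn; congr (_ ^- _); lia.
rewrite [X in _ * X]big1 => [|j hj].
  rewrite !mulr1; congr (_ / (_ * _ * _) * _ * _); congr qpoch; lia.
rewrite big_pred0 // => k; apply/negbTE/negP.
rewrite !eE; move: hj; rewrite /e !inE; do 4?case: ifP; lia.
Qed.

(** Only the [d - r + 1] sign patterns of [Acoef_neq0_seg] survive, and they are
    indexed by the number [p] of signs +1. Splitting the q-multinomial
    coefficient of [Acoef_seg] into two binomials, one of them constant in [p],
    leaves a Rogers-Szego polynomial. *)
Lemma sum_Acoef r : (r <= d)%N ->
  \sum_(Ip : {set 'I_m} | Ip \subset Jc n m lam nu)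
    \sum_(Im : {set 'I_m} | [&& Im \subset Jc n m lam nu, [disjoint Ip & Im]
                            & (#|Ip| + #|Im| == d - r)%N])
      Acoef n q t0 lam nu Ip Im
  = gauss _ q d r * rogers_szego _ q (t0^-1 * q ^- r) t0 (d - r).
Proof.
move=> le_rd; rewrite hJ pair_big_dep /=.
pose h (p : 'I_(d - r).+1) := (seg m g (g + p), seg m (g + p + r) (g + d)).
pose h' (I : {set 'I_m} * {set 'I_m}) : 'I_(d - r).+1 := inord #|I.1|.
rewrite (bigID (fun I => h (h' I) == I)) /= [X in _ + X]big1 ?addr0; last first.
  move=> [Ip Im] /= /andP[/andP[sp /and3P[sm dis /eqP card_eq]]].
  apply: contraNeq => nz; have [ep em] := Acoef_neq0_seg Ip Im sp sm dis nz.
  rewrite /h /h' /= inordK; last by rewrite ltnS -card_eq leq_addr.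
  rewrite -ep xpair_eqE eqxx /=; apply/eqP; rewrite [RHS]em; congr (seg m).
  by move: #|Ip| #|Im| card_eq => a b; lia.
have hP p : (p <= d - r)%N -> #|seg m g (g + p)| = p by move=> ?; rewrite card_seg; lia.
rewrite (reindex_onto h h') /=; last by move=> I /andP[_ /eqP].
rewrite rogers_szego_sum big_mkord big_distrr /=.
apply: eq_big => [p|p _]; last first.
  have le_p : (p <= d - r)%N by rewrite -ltnS.
  rewrite -/(A _ _) Acoef_seg; last by lia.
  rewrite exprMn exprVn exprVn -exprM (mulnC r).
  rewrite -(gauss_qpoch _ _ d r) // -(gauss_qpoch _ _ (d - r) p) //.
  have -> : (d - p - r = d - r - p)%N by lia.
  have nz := qpoch_neq0 _ _ q1.
  move: (q ^- _) (t0 ^- _) (nz p) (nz r) (nz (d - r - p)%N) => y z n1 n2 n3.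
  by field; rewrite n1 n2 n3.
have le_p : (p <= d - r)%N by rewrite -ltnS.
have h'h : h' (h p) = p by rewrite /h' /h /= hP // inord_val.
rewrite h'h !eqxx !andbT; apply/and4P; split.
- by apply/fintype.subsetP => j; rewrite !inE; lia.
- by apply/fintype.subsetP => j; rewrite !inE; lia.
- by apply/pred0P => j; rewrite /= !inE; lia.
- by rewrite hP // card_seg //; lia.
Qed.

End Coefficients.

(** * Interlacing partitions *)

Lemma part_ge l i : (size l < i)%N -> part l i = 0%N.
Proof. by case: i => // i; rewrite ltnS /part => le_li; rewrite nth_default. Qed.

Lemma sorted_part l i : sorted geq l -> (0 < i)%N -> (part l i.+1 <= part l i)%N.
Proof.
case: i => // i; rewrite /part /=.
elim: l i => [|x l IH] i /= s_l _; first by rewrite !nth_nil.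
case: i => [|i] /=; first by case: l s_l {IH} => //= y l /andP[].
by apply: IH => //; apply: path_sorted s_l.
Qed.

Lemma ltn_trpart l i k : sorted geq l -> (0 < k)%N ->
  (i < trpart l k)%N = (k <= part l i.+1)%N.
Proof.
move=> s_l k0; elim: l i s_l => [|x l IH] i s_l.
  by rewrite /part nth_nil leqn0 (gtn_eqF k0).
have s_l' := path_sorted s_l.
have le_x : all (geq x) l.
  by apply: order_path_min s_l => a b c /= h1 h2; apply: leq_trans h2 h1.
rewrite /trpart /= -/(trpart l k) /part /=.
have [le_kx|lt_xk] := leqP k x; first by case: i => [|i] //=; rewrite add1n ltnS IH.
have -> : trpart l k = 0%N.
  apply/eqP; rewrite -leqn0 leqNgt -has_count; apply/hasPn => y /(allP le_x) /= le_yx.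
  by rewrite -ltnNge; apply: leq_ltn_trans lt_xk.
symmetry; case: i => [|i] /=; first by rewrite leqNgt lt_xk.
apply/negbTE; rewrite -ltnNge.
have [lt_il|?] := ltnP i (size l); last by rewrite nth_default.
apply: leq_ltn_trans lt_xk; exact: (allP le_x _ (mem_nth _ lt_il)).
Qed.

Lemma sumn_part l N : (size l <= N)%N -> sumn l = (\sum_(1 <= i < N.+1) part l i)%N.
Proof.
move=> le_lN; rewrite big_add1 /= (big_cat_nat (n := size l)) //=.
rewrite [X in (_ + X)%N]big_nat [X in (_ + X)%N]big1 ?addn0.
  by rewrite sumnE (big_nth 0%N).
by move=> i /andP[le_li _]; rewrite /part nth_default.
Qed.

Section Interlacing.
Variables (n : nat) (lam nu : seq nat).
Hypotheses (hlam : lam \in Lambda n) (hnu : nu \in Lambda n.-1).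
Hypothesis n0 : (0 < n)%N.

(** An intermediate partition [mu] between [nu] and [lam] is a choice of parts
    [mu_i] in the ranges from [lo_part i] to [hi_part i]; see [interlacingP]. The
    ranges do not overlap, since [hi_part i.+1] and [lo_part i] are the smaller
    and the larger of [part nu i] and [part lam i.+1] for [i >= 1]. *)
Definition lo_part i := maxn (part nu i) (part lam i.+1).
Definition hi_part i := min_prev nu lam i.

Hypothesis le_lo_hi : forall i, (1 <= i <= n)%N -> (lo_part i <= hi_part i)%N.

Let lam_sorted : sorted geq lam. Proof. by case/andP: hlam. Qed.
Let nu_sorted : sorted geq nu. Proof. by case/andP: hnu. Qed.
Let lam_size : size lam = n. Proof. by case/andP: hlam => /eqP. Qed.
Let nu_size : size nu = n.-1. Proof. by case/andP: hnu => /eqP. Qed.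

Lemma hi_part1 : hi_part 1 = part lam 1. Proof. by []. Qed.
Lemma hi_partS i : (0 < i)%N -> hi_part i.+1 = minn (part nu i) (part lam i.+1).
Proof. by case: i. Qed.

Lemma hi_part_le i : (0 < i)%N -> (hi_part i <= part lam i)%N.
Proof. by case: i => // -[_|i _]; rewrite ?hi_part1 // hi_partS // geq_minr. Qed.

Lemma lo_part_ge i : (part lam i.+1 <= lo_part i)%N. Proof. exact: leq_maxr. Qed.

Lemma lo_part_n : lo_part n = 0%N.
Proof. by rewrite /lo_part !part_ge ?lam_size ?nu_size // prednK. Qed.

Lemma trpart_lam i k : (0 < i)%N -> (part lam i.+1 < k <= part lam i)%N ->
  trpart lam k = i.
Proof.
case: i => // i _ /andP[lt_k le_k]; have k0 : (0 < k)%N by lia.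
have := ltn_trpart _ i k lam_sorted k0; have := ltn_trpart _ i.+1 k lam_sorted k0; lia.
Qed.

Lemma trpart_lam_inv i k : (0 < i)%N -> (0 < k)%N -> trpart lam k = i ->
  (part lam i.+1 < k <= part lam i)%N.
Proof.
case: i => // i _ k0 e.
have := ltn_trpart _ i k lam_sorted k0; have := ltn_trpart _ i.+1 k lam_sorted k0; lia.
Qed.

(** By interlacing, [nu] has height [i], [i - 1] or [i - 2] on the columns where
    [lam] has height [i]; the two booleans locate the jumps. *)
Lemma trpart_nu i k : (1 <= i <= n)%N -> (part lam i.+1 < k <= part lam i)%N ->
  (trpart nu k + (lo_part i < k) + (hi_part i < k))%N = i.
Proof.
case: i => // i le_in /andP[lt_k le_k]; have k0 : (0 < k)%N by lia.
have up : (k <= part nu i.+2)%N = false.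
  have [lt_in|ge_in] := ltnP i.+1 n; last by rewrite part_ge ?nu_size; lia.
  have := le_lo_hi i.+2 lt_in; rewrite hi_partS // /lo_part; lia.
have h2 := ltn_trpart _ i.+1 k nu_sorted k0; have h1 := ltn_trpart _ i k nu_sorted k0.
rewrite up in h2.
case: i => [|i] in le_in lt_k le_k up h1 h2 *.
  by rewrite hi_part1 /lo_part; lia.
have h0 := ltn_trpart _ i k nu_sorted k0.
rewrite hi_partS // /lo_part.
case: i => [|i] in le_in lt_k le_k up h1 h2 h0 *; first lia.
have h3 := ltn_trpart _ i k nu_sorted k0.
have := le_lo_hi i.+2; rewrite hi_partS // /lo_part; lia.
Qed.

Lemma part_lam_anti i j : (0 < i)%N -> (i <= j)%N -> (part lam j <= part lam i)%N.
Proof.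
move=> i0; elim: j => [|j IH]; first by lia.
rewrite leq_eqVlt => /orP[/eqP-> //|lt_ij].
by apply: leq_trans (IH lt_ij); apply: sorted_part lam_sorted _; lia.
Qed.

Section Constants.
Variables (F : fieldType) (q : F).
Hypothesis q1 : forall k, (0 < k)%N -> q ^+ k != 1.

Lemma prod_columns (G : nat -> F) :
  \prod_(1 <= j < (part lam 1).+1) G j =
  \prod_(1 <= i < n.+1) \prod_((part lam i.+1).+1 <= j < (part lam i).+1) G j.
Proof.
have step h : \prod_((part lam h.+1).+1 <= j < (part lam 1).+1) G j =
  \prod_(1 <= i < h.+1) \prod_((part lam i.+1).+1 <= j < (part lam i).+1) G j.
  elim: h => [|h IH]; first by rewrite !big_geq.
  rewrite [RHS]big_nat_recr //= -IH mulrC -big_cat_nat //= ltnS.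
    exact: sorted_part.
  exact: part_lam_anti.
by rewrite -step (part_ge lam n.+1) // lam_size.
Qed.

(** The pairs of columns in [ccoef] have the same height in [lam], so the
    product splits over the heights [i]; by [trpart_nu] each factor is a product
    over the pairs from distinct blocks among three. *)
Lemma ccoefE : ccoef (part lam 1) q lam nu =
  \prod_(1 <= i < n.+1)
    (qpoch q q (part lam i - part lam i.+1)
     / (qpoch q q (lo_part i - part lam i.+1) * qpoch q q (hi_part i - lo_part i)
        * qpoch q q (part lam i - hi_part i))).
Proof.
rewrite /ccoef prod_columns !big_nat; apply: eq_bigr => i i_in.
have le1 := lo_part_ge i; have le2 := le_lo_hi i i_in; have i0 : (0 < i)%N by lia.
have le3 := hi_part_le i i0.
have le4 : (part lam i <= part lam 1)%N by exact: part_lam_anti.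
(* The columns of height [i] start at [(part lam i.+1).+1]. *)
rewrite -[(part lam i - part lam i.+1)%N]subSS -[(lo_part i - _)%N]subSS.
rewrite -[(hi_part i - _)%N]subSS -[(part lam i - hi_part i)%N]subSS.
rewrite -(prod_qratio_blocks _ _ q1 (fun j k => (trpart nu k < trpart nu j)%N)) //; last first.
  move=> j k hj hk; have := trpart_nu i j i_in; have := trpart_nu i k i_in; lia.
rewrite !big_nat; apply: eq_bigr => j hj.
rewrite (big_nat_widenl j.+1 1) // (big_nat_widenl (part lam i.+1).+1 1) //.
rewrite [RHS](big_nat_widen _ _ (part lam 1).+1) //.
rewrite [LHS]big_nat_cond [RHS]big_nat_cond; apply: eq_bigl => k.
case: (boolP (1 <= k < _)%N) => //= hk.
have lj := trpart_lam i j i0 hj; rewrite lj.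
have vj := trpart_nu i j i_in hj.
apply/idP/idP.
  move=> /andP[/andP[lt_v /eqP lk] lt_jk].
  have := trpart_lam_inv i k i0 _ lk; rewrite lt_v; lia.
move=> /andP[/andP[lt_v h1] h2]; have hk' : (part lam i.+1 < k <= part lam i)%N by lia.
rewrite lt_v (trpart_lam i k i0 hk') eqxx /=.
have := trpart_nu i k i_in hk'; lia.
Qed.

End Constants.

Section OneStep.
Variable s : nat.
Hypotheses (hs : (1 <= s <= n)%N)
  (eq_lo_hi : forall i, (1 <= i <= n)%N -> i <> s -> lo_part i = hi_part i).

Let m := part lam 1.

Lemma hi_part_le_m : (hi_part s <= m)%N.
Proof. by apply: (leq_trans (hi_part_le s _)); [lia | apply: part_lam_anti; lia]. Qed.

Lemma trpart_lam_range k : (1 <= k <= m)%N -> (1 <= trpart lam k <= n)%N.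
Proof.
move=> hk; have := ltn_trpart _ 0 k lam_sorted; have := ltn_trpart _ n k lam_sorted.
rewrite (part_ge _ n.+1) ?lam_size // -/m; lia.
Qed.

(** For [i <> s] the middle block of height [i] is empty, hence only the block of
    height [s] has columns on which the heights differ by one. *)
Lemma trpart_eqS k : (1 <= k <= m)%N ->
  (trpart lam k == (trpart nu k).+1) = (lo_part s < k <= hi_part s)%N.
Proof.
move=> hk; have ri := trpart_lam_range k hk; set i := trpart lam k in ri *.
have hki : (part lam i.+1 < k <= part lam i)%N by apply: trpart_lam_inv; lia.
have e := trpart_nu i k ri hki.
have hls := le_lo_hi i ri.
have [eis|/eqP nis] := eqVneq i s; first by rewrite -eis; lia.
have ei := eq_lo_hi i ri nis.
have [lt|gt|//] := ltngtP i s.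
  have := hi_part_le s; have := part_lam_anti i.+1 s; lia.
have := lo_part_ge s; have := part_lam_anti s.+1 i; lia.
Qed.

(** The ordinal [j] stands for the column [m - j]. *)
Lemma Jc_seg : Jc n m lam nu =
  seg m (m - hi_part s) (m - hi_part s + (hi_part s - lo_part s)).
Proof.
have le := le_lo_hi s hs; have le_m := hi_part_le_m.
apply/setP => j; rewrite !inE /nustar /lamstar.
have lt_jm := ltn_ord j.
have hk : (1 <= m - j <= m)%N by lia.
have := trpart_eqS _ hk; have := trpart_lam_range _ hk.
have : (trpart nu (m - j) <= n)%N.
  by rewrite (leq_trans (count_size _ _)) // nu_size leq_pred.
lia.
Qed.

Lemma nustar_seg (j k : 'I_m) :
    j \in seg m (m - hi_part s) (m - hi_part s + (hi_part s - lo_part s)) ->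
    k \in seg m (m - hi_part s) (m - hi_part s + (hi_part s - lo_part s)) ->
  nustar n nu j = nustar n nu k.
Proof.
have le := le_lo_hi s hs; have le_m := hi_part_le_m.
have le1 := lo_part_ge s.
have le2 : (hi_part s <= part lam s)%N by apply: hi_part_le; lia.
have lt_j := ltn_ord j; have lt_k := ltn_ord k.
rewrite !inE /nustar => hj hk.
have := trpart_nu s (m - j) hs; have := trpart_nu s (m - k) hs; lia.
Qed.

Lemma ddegE : ddeg m lam nu = (hi_part s - lo_part s)%N.
Proof.
have le := le_lo_hi s hs; have le_m := hi_part_le_m.
rewrite /ddeg -sum1_count.
transitivity (\sum_((lo_part s).+1 <= k < (hi_part s).+1) 1)%N; last first.
  by rewrite sum_nat_const_nat muln1 subSS.
rewrite (big_nat_widenl _ 1) // (big_nat_widen _ _ m.+1) //.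
rewrite /index_iota subn1 /= 2![in LHS]big_seq_cond [RHS]big_seq_cond.
apply: eq_bigl => k; rewrite mem_iota add1n ltnS.
by case: (boolP (1 <= k <= m)%N) => //= hk; rewrite trpart_eqS //; lia.
Qed.

End OneStep.

Lemma sum_lo_hi :
  (\sum_(1 <= i < n.+1) (lo_part i + hi_part i) = sumn nu + sumn lam)%N.
Proof.
rewrite (sumn_part nu n) ?(sumn_part lam n) ?lam_size ?nu_size ?leq_pred //.
rewrite big_split /=.
rewrite big_nat_recr //= lo_part_n addn0 [in RHS]big_nat_recr //=.
rewrite (part_ge nu) ?nu_size ?prednK // addn0.
rewrite (big_ltn (F := hi_part)) // (big_ltn (F := part lam)) // !big_add1 /= hi_part1.
rewrite addnCA [RHS]addnCA -!big_split /=; congr (_ + _)%N.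
rewrite !big_nat; apply: eq_bigr => i /andP[i0 _].
by rewrite hi_partS // /lo_part; lia.
Qed.

Lemma interlacingP mu : size mu = n ->
  reflect (forall i, (1 <= i <= n)%N -> (lo_part i <= part mu i <= hi_part i)%N)
          [&& mu \in Lambda n, interlace nu mu & interlace mu lam].
Proof.
move=> sz_mu; apply: (iffP and3P).
  move=> [_ /allP h1 /allP h2] i i_in.
  rewrite sz_mu in h1; rewrite lam_size in h2.
  have := h1 i; have := h2 i; rewrite mem_iota add1n ltnS i_in.
  move=> /(_ isT) h2i /(_ isT) h1i.
  rewrite /lo_part geq_max; case: i i_in h1i h2i => [//|[|i]] i_in h1i h2i.
    by rewrite hi_part1; lia.
  rewrite hi_partS //; have := h1 i.+1; rewrite mem_iota add1n ltnS => /(_ ltac:(lia)); lia.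
move=> h; split.
- rewrite inE sz_mu eqxx /=; apply/(sortedP 0%N) => i; rewrite sz_mu => lt_in.
  have := h i.+1; have := h i.+2; rewrite hi_partS // /lo_part /part /=; lia.
- apply/allP => i; rewrite sz_mu mem_iota add1n ltnS => i_in.
  have := h i i_in; have := h i.+1; rewrite hi_partS; last lia.
  rewrite /lo_part; have [lt_in|ge_in] := ltnP i n; first lia.
  by rewrite (part_ge mu) ?sz_mu ?ltnS // => _; lia.
apply/allP => i; rewrite lam_size mem_iota add1n ltnS => i_in.
have := h i i_in; have := hi_part_le i; rewrite /lo_part; lia.
Qed.

(** * The weights of the polynomial Q *)

Section Weight.
Variables (F : fieldType) (q : F).
Hypothesis q1 : forall k, (0 < k)%N -> q ^+ k != 1.

(** As [lo_part i] and [hi_part i.+1] are [part nu i] and [part lam i.+1] in some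
    order, attaining one of them makes [mu] meet [nu] or [lam]; then the
    q-factorials either are [qpoch q q 0 = 1] or cancel in pairs. The right side
    separates the row [i] from the row [i.+1], and its numerators are the
    denominators of the other binomials of [Qweight]. *)
Lemma qbinom_tight_split (mu : seq nat) i : (1 <= i < n)%N ->
    (lo_part i <= part mu i <= hi_part i)%N ->
    (lo_part i.+1 <= part mu i.+1 <= hi_part i.+1)%N ->
    lo_part i = part mu i \/ part mu i.+1 = hi_part i.+1 ->
  qbinom q (part mu i - part mu i.+1) (part mu i - part nu i) =
  qpoch q q (part mu i - part lam i.+1)
    / (qpoch q q (part mu i - lo_part i) * qpoch q q (lo_part i - part lam i.+1))
  * (qpoch q q (part lam i.+1 - part mu i.+1)
    / (qpoch q q (hi_part i.+1 - part mu i.+1)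
       * qpoch q q (part lam i.+1 - hi_part i.+1))).
Proof.
move=> i_in h1 h2 tight; have nz := qpoch_neq0 _ _ q1.
have qp0 : qpoch q q 0 = 1 by rewrite /qpoch big_ord0.
rewrite /qbinom.
have -> : (part mu i - part mu i.+1 - (part mu i - part nu i) = part nu i - part mu i.+1)%N.
  by move: h1 h2; rewrite hi_partS /lo_part; lia.
move: h1 h2 tight; rewrite hi_partS /lo_part; last lia.
have [le|/ltnW le] := leqP (part nu i) (part lam i.+1).
  by move=> h1 h2 [<-|->];
    rewrite !subnn qp0; field; rewrite ?qp0 !nz ?oner_neq0.
by move=> h1 h2 [<-|->];
  rewrite !subnn qp0; field; rewrite ?qp0 !nz ?oner_neq0.
Qed.

(** Collecting the two factors of [qbinom_tight_split] that belong to the same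
    row makes the weight a product over the rows, in which every row splits off
    its factor of [ccoef]. *)
Lemma QweightE (x : F) mu :
    (forall i, (1 <= i <= n)%N -> (lo_part i <= part mu i <= hi_part i)%N) ->
    (forall i, (1 <= i < n)%N ->
       lo_part i = part mu i \/ part mu i.+1 = hi_part i.+1) ->
    size mu = n ->
  Qweight n x q nu lam mu =
    x ^ (\sum_(1 <= i < n.+1)
           (2 * (part mu i)%:Z - (lo_part i)%:Z - (hi_part i)%:Z))
    * (ccoef (part lam 1) q lam nu
       * \prod_(1 <= i < n.+1)
           gauss _ q (hi_part i - lo_part i) (part mu i - lo_part i)).
Proof.
move=> h tight sz_mu; have nz := qpoch_neq0 _ _ q1.
have qp0 : qpoch q q 0 = 1 by rewrite /qpoch big_ord0.
pose L := part lam; pose M := part mu.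
pose U i := qpoch q q (M i - L i.+1)
  / (qpoch q q (M i - lo_part i) * qpoch q q (lo_part i - L i.+1)).
pose V i := qpoch q q (L i - M i)
  / (qpoch q q (hi_part i - M i) * qpoch q q (L i - hi_part i)).
rewrite /Qweight -mulrA; congr (_ ^ _ * _).
  rewrite !sumrB -big_distrr /= -!(big_morph _ PoszD (erefl _)).
  rewrite -(sumn_part mu n) ?sz_mu // -addrA -opprD -addrA -opprD; congr (_ - _).
  by rewrite -!PoszD -sum_lo_hi big_split.
rewrite ccoefE // -[RHS]big_split /= [X in X * _ = _]big_split /=.
have -> : \prod_(1 <= i < n) qbinom q (part mu i - part mu i.+1) (part mu i - part nu i)
     = \prod_(1 <= i < n.+1) (U i * V i).
  rewrite [RHS]big_split /= (big_nat_recr _ _ U) //= (big_ltn (F := V)) //=.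
  (* The boundary factors are trivial, as [lo_part n = 0] and [hi_part 1] is the
     largest part of [lam]. *)
  have -> : U n = 1.
    by rewrite /U lo_part_n /L part_ge ?lam_size // !subn0 qp0 mulr1 divff.
  have -> : V 1%N = 1 by rewrite /V hi_part1 subnn qp0 mulr1 divff.
  rewrite [X in _ = _ * (_ * X)]big_add1 /= mul1r mulr1 -big_split !big_nat.
  apply: eq_bigr => i i_in.
  by apply: qbinom_tight_split => //; [apply: h | apply: h | apply: tight]; lia.
have -> : qbinom q (part lam n) (part lam n - part mu n)
   = qbinom q (L n - L n.+1) (L n - M n).
  by rewrite /L (part_ge lam n.+1) ?lam_size // subn0.
rewrite mulrAC.
rewrite -[X in X * _](big_nat_recr n 1
  (fun i => qbinom q (L i - L i.+1) (L i - M i))) //.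
rewrite -big_split !big_nat; apply: eq_bigr => i i_in /=.
have := h i i_in; have le1 := lo_part_ge i; have le2 := hi_part_le i => hM.
have e := gauss_qpoch _ q (hi_part i - lo_part i) (part mu i - lo_part i).
rewrite -e; last lia.
rewrite /qbinom /U /V /L /M.
have -> : (part lam i - part lam i.+1 - (part lam i - part mu i)
  = part mu i - part lam i.+1)%N by lia.
have -> : (hi_part i - lo_part i - (part mu i - lo_part i)
  = hi_part i - part mu i)%N by lia.
by field; rewrite !nz gauss_neq0 //; lia.
Qed.

End Weight.

(** * Both polynomials when a single part is free *)

Section OneStepSums.
Variables (F : fieldType) (q : F).
Hypothesis q1 : forall k, (0 < k)%N -> q ^+ k != 1.
Variable s : nat.
Hypotheses (hs : (1 <= s <= n)%N)
  (eq_lo_hi : forall i, (1 <= i <= n)%N -> i <> s -> lo_part i = hi_part i).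

Lemma QpolyE (x : F) : x != 0 ->
  Qpoly n x q nu lam =
  ccoef (part lam 1) q lam nu * rogers_szego _ q x x^-1 (hi_part s - lo_part s).
Proof.
move=> x0; set m := part lam 1; set d := (hi_part s - lo_part s)%N.
have le_s := le_lo_hi s hs.
pose M k i := if i == s then (lo_part s + k)%N else lo_part i.
have M_range k i : (k <= d)%N -> (1 <= i <= n)%N -> (lo_part i <= M k i <= hi_part i)%N.
  move=> le_kd i_in; rewrite /M; have := le_lo_hi i i_in.
  by case: eqVneq => [->|_]; rewrite /d in le_kd; lia.
have M_m k i : (k <= d)%N -> (1 <= i <= n)%N -> (M k i < m.+1)%N.
  move=> le_kd i_in; have := M_range k i le_kd i_in; have := hi_part_le i.
  have := part_lam_anti 1 i; rewrite -/m; lia.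
pose h (k : 'I_d.+1) : n.-tuple 'I_m.+1 := [tuple inord (M k i.+1) | i < n].
pose mu (t : n.-tuple 'I_m.+1) := [seq val p | p <- t].
have sz_mu t : size (mu t) = n by rewrite size_map size_tuple.
have part_mu (t : n.-tuple 'I_m.+1) (i : 'I_n) : part (mu t) i.+1 = tnth t i.
  rewrite /part /= (nth_map (tnth t i)) ?size_tuple //.
  by rewrite -tnth_nth.
have part_h (k : 'I_d.+1) i : (1 <= i <= n)%N -> part (mu (h k)) i = M k i.
  case: i => // i i_in; have lt_in : (i < n)%N by lia.
  rewrite (part_mu _ (Ordinal lt_in)) tnth_mktuple /= inordK //.
  by apply: M_m => //; rewrite -ltnS.
pose h' (t : n.-tuple 'I_m.+1) : 'I_d.+1 := inord (part (mu t) s - lo_part s).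
rewrite /Qpoly -/m.
under eq_bigl => t do rewrite -/(mu t).
(* A tuple is determined by its part at [s], that is, by the offset [k] of this
   part from [lo_part s]. *)
rewrite (reindex_onto h h'); last first.
  move=> t /(interlacingP _ (sz_mu t)) ht; apply: eq_from_tnth => i.
  have i_in : (1 <= i.+1 <= n)%N by rewrite /=.
  apply: ord_inj; rewrite -!part_mu part_h // /M /h'.
  case: eqVneq => [->|/eqP ns].
    by have := ht s hs => hts; rewrite inordK /d; lia.
  by have := ht i.+1 i_in; rewrite (eq_lo_hi _ i_in ns); lia.
rewrite rogers_szego_sum big_mkord big_distrr /=.
have s0 : (0 < s)%N by lia.
apply: eq_big => [k|k _].
  have le_kd : (k <= d)%N by rewrite -ltnS.
  apply/andP; split; last first.
    by rewrite /h' part_h // /M eqxx addKn inord_val.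
  apply/(interlacingP _ (sz_mu _)) => i i_in.
  by rewrite part_h //; apply: M_range.
have le_kd : (k <= d)%N by rewrite -ltnS.
rewrite -/(mu (h k)) QweightE //; last first.
- move=> i i_in; rewrite !part_h; [|lia|lia].
  have [is_s|ns] := eqVneq i s; last by left; rewrite /M (negbTE ns).
  rewrite is_s in i_in *.
  right; rewrite /M; case: eqVneq => [|_]; first lia.
  by apply: eq_lo_hi; lia.
- by move=> i i_in; rewrite part_h //; apply: M_range.
rewrite mulrCA; congr (_ * _).
have s_in : s \in index_iota 1 n.+1 by rewrite mem_index_iota.
have off i : i \in index_iota 1 n.+1 -> i != s ->
    part (mu (h k)) i = lo_part i /\ hi_part i = lo_part i.
  rewrite mem_index_iota => i_in ns.
  by rewrite part_h // /M (negbTE ns) eq_lo_hi //; apply/eqP.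
rewrite mulrC (bigD1_seq s) ?iota_uniq //= (bigD1_seq s) ?iota_uniq //=.
rewrite part_h // {1 2}/M eqxx addKn.
rewrite big1_seq => [|i /andP[ns /off /(_ ns)[-> ->]]]; last by rewrite subnn.
rewrite big1_seq => [|i /andP[ns /off /(_ ns)[-> ->]]]; last by lia.
rewrite mulr1 addr0 -mulrA; congr (_ * _).
have -> : 2 * (lo_part s + k)%N%:Z - (lo_part s)%:Z - (hi_part s)%:Z
  = k%:Z - (d - k)%N%:Z.
  by rewrite /d in le_kd *; lia.
by rewrite expfzDr // -exprnP -invr_expz exprVn.
Qed.

Lemma PbranchE (x t0 : F) : q != 0 -> x != 0 -> t0 != 0 ->
  Pbranch n x q t0 lam nu
  = ccoef (part lam 1) q lam nu * rogers_szego _ q x x^-1 (hi_part s - lo_part s).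
Proof.
move=> q0 x0 t00; have le_m := hi_part_le_m s hs; have le_s := le_lo_hi s hs.
rewrite /Pbranch (ddegE s hs eq_lo_hi).
rewrite -(sum_askey_rogers_szego _ _ q1 q0 x t0) // big_distrr /= !big_nat.
apply: eq_bigr => r /andP[_ lt_r]; rewrite mulrA; congr (_ * _).
rewrite /Bcoef (ddegE s hs eq_lo_hi); congr (_ * _).
apply: (sum_Acoef _ _ q1 _ _ _ _ _ _ _ (Jc_seg s hs eq_lo_hi)) => //; first by lia.
exact: nustar_seg.
Qed.

End OneStepSums.
End Interlacing.

(** * The limit *)

Local Open Scope complex_scope.
Local Open Scope classical_set_scope.

Theorem proposition2p5p4 (R : realType) (q : R) (x : Cplx R) (n : nat)
    (lam nu : seq nat)
    (hq : 0 < q < 1) (hx : x != 0) (hn : (0 < n)%N)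
    (hlam : lam \in Lambda n) (hnu : nu \in Lambda n.-1)
    (hs : exists! s : nat,
       [/\ (1 <= s <= n)%N,
           (maxn (part nu s) (part lam s.+1) < min_prev nu lam s)%N
         & forall j : nat, (1 <= j <= n)%N -> j <> s ->
           maxn (part nu j) (part lam j.+1) = min_prev nu lam j]) :
  Pbranch n x (q%:C : Cplx R) t0 lam nu @[t0 --> (0 : Cplx R)^'] -->
    Qpoly n x (q%:C : Cplx R) nu lam.
Proof.
case: hs => s [[s_n lt_s eq_ns] _].
have q0 : (q%:C : Cplx R) != 0.
  by rewrite (fmorph_eq0 (real_complex R)); case/andP: hq => /lt0r_neq0.
have q1 k : (0 < k)%N -> (q%:C : Cplx R) ^+ k != 1.
  move=> k0; have -> : (q%:C : Cplx R) ^+ k = (q ^+ k)%:C.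
    by rewrite (rmorphXn (real_complex R)).
  rewrite -(rmorph1 (real_complex R)) (inj_eq (fmorph_inj (real_complex R))).
  by case/andP: hq => /ltW q_ge0 q_lt1; rewrite lt_eqF // exprn_ilt1 // -lt0n.
have le_lo_hi i : (1 <= i <= n)%N -> (lo_part lam nu i <= hi_part lam nu i)%N.
  move=> i_in; have [->|/eqP ns] := eqVneq i s; first exact: ltnW.
  by rewrite /lo_part eq_ns.
apply: cvg_near_cst; near=> t.
rewrite (PbranchE n lam nu hlam hnu hn le_lo_hi _ _ q1 s s_n eq_ns) //.
  by rewrite (QpolyE n lam nu hlam hnu hn le_lo_hi _ _ q1 s s_n eq_ns).
near: t; exact: nbhs_dnbhs_neq.
Unshelve. all: by end_near.
Qed.
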